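(* Let $\alpha\in(0,1]$ and suppose the candidate-family process $\mathcal C=(\mathcal C_t)_{t\ge0}$ controls simultaneous stopped FDR at level $\alpha$. For every nonempty finite $S\subseteq\mathcal I$, define $$E_t^{S,\mathrm{can}}:=\frac1\alpha\max_{R\in\mathcal C_t}\mathrm{FDP}_{S\cap I_t}(R).$$ Then $\mathbf E^{\mathrm{can}}=(E^{S,\mathrm{can}}_t)$ is a future-extension coherent dynamic intersection $e$-process collection and $$\mathcal C_t\subseteq\mathfrak R_{\alpha,t}(\mathbf E^{\mathrm{can}})\qquad\text{for every }t .$$
   Context: Let $(\Omega,\mathcal F,(\mathcal F_t)_{t\in\mathbb N_0})$ be a discrete-time filtered measurable space, $\mathcal M$ a family of probability measures on $(\Omega,\mathcal F)$, $\mathcal I\subseteq\mathbb N$ an index set (finite or infinite), and $H_i\subseteq\mathcal M$, $i\in\mathcal I$, null hypotheses. Put $\mathcal N(P)=\{i\in\mathcal I:P\in H_i\}$ and, for finite $S\subseteq\mathcal I$, $H_S=\bigcap_{i\in S}H_i$ (with $H_\varnothing=\mathcal M$). The active sets $I_t\subseteq\mathcal I$ are deterministic and finite with $I_0\subseteq I_1\subseteq\cdots$ and $\bigcup_t I_t=\mathcal I$. For a finite $R\subseteq\mathcal I$ and any $S\subseteq\mathcal I$, $\mathrm{FDP}_S(R)=|S\cap R|/(|R|\vee 1)$. A candidate-family process $\mathcal C=(\mathcal C_t)_{t\ge0}$ consists of nonempty random families $\mathcal C_t\subseteq 2^{I_t}$ with $\{R\in\mathcal C_t\}\in\mathcal F_t$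 for every deterministic $R\subseteq I_t$. It controls simultaneous stopped FDR at level $\alpha$ if $\mathbb E_P[\max_{R\in\mathcal C_\tau}\mathrm{FDP}_{\mathcal N(P)\cap I_\tau}(R)]\le\alpha$ for every $P\in\mathcal M$ and every $(\mathcal F_t)$-stopping time $\tau$ with $P(\tau<\infty)=1$. A nonnegative $(\mathcal F_t)$-adapted process $E=(E_t)_{t\ge0}$ is an $e$-process for $H\subseteq\mathcal M$ if $\mathbb E_P[E_\tau]\le1$ for every $P\in H$ and every $(\mathcal F_t)$-stopping time $\tau$ with $P(\tau<\infty)=1$. A dynamic intersection $e$-process collection is a family $\mathbf E=(E^S_t)_{t\ge0,\ S\subseteq\mathcal I,\ 0<|S|<\infty}$ such that $E^S$ is an $e$-process for $H_S$ for each nonempty finite $S$. It is future-extension coherent if, pointwise on $\Omega$, $E_t^{S\cap I_t}\le E_t^S$ for every $t$ and every finite $S$ with $S\cap I_t\ne\varnothing$. The closure family at time $t$ is $\mathfrak R_{\alpha,t}(\mathbf E)=\{R\subseteq I_t:\ \mathrm{FDP}_S(R)\le\alpha E^S_t\text{ for every nonempty }S\subseteq I_t\}$. *)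

(* Defs.v *)
From HB Require Import structures.
From mathcomp Require Import all_boot all_order all_algebra finmap.
From mathcomp Require Import all_classical all_reals all_analysis.

Set Implicit Arguments.
Unset Strict Implicit.
Unset Printing Implicit Defensive.

Import Order.TTheory GRing.Theory Num.Theory.
Import numFieldNormedType.Exports.

Local Open Scope classical_set_scope.
Local Open Scope ring_scope.

Definition is_filtration d (T : measurableType d) (F : nat -> set (set T)) :
    Prop :=
  [/\ forall t, sigma_algebra [set: T] (F t),
      forall t, F t `<=` measurable
    & forall s t, (s <= t)%N -> F s `<=` F t].

(* Random times take values in nat plus infinity; [None] is infinity. *)
Definition stopping_time d (T : measurableType d) (F : nat -> set (set T))
    (tau : T -> option nat) : Prop :=
  forall t : nat,
    F t [set w | exists2 s : nat, tau w = Some s & (s <= t)%N].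

Definition as_finite d (T : measurableType d) (R : realType)
    (P : probability T R) (tau : T -> option nat) : Prop :=
  P [set w | tau w != None] = 1%E.

(* X_tau; the value 0 on {tau = oo} is immaterial, since X_tau is only used
   for times that are almost surely finite. *)
Definition stopped (T : Type) (R : realType) (X : nat -> T -> R)
    (tau : T -> option nat) (w : T) : R :=
  if tau w is Some t then X t w else 0.

Definition adapted d (T : measurableType d) (R : realType)
    (F : nat -> set (set T)) (X : nat -> T -> R) : Prop :=
  forall t : nat,
    measurable_fun [set: g_sigma_algebraType (F t)]
      (X t : g_sigma_algebraType (F t) -> R).

Definition active_sets (I : set nat) (It : nat -> {fset nat}) : Prop :=
  (forall s t, (s <= t)%N -> (It s `<=` It t)%fset) /\
  \bigcup_t [set` It t] = I.

Definition true_nulls (Q : Type) (I : set nat) (H : nat -> set Q) (P : Q) :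
    set nat :=
  [set i | I i /\ H i P].

(* Intersecting with the whole model M gives H_emptyset = M. *)
Definition inter_null (Q : Type) (M : set Q) (H : nat -> set Q)
    (S : {fset nat}) : set Q :=
  M `&` \bigcap_(i in [set` S]) H i.

Definition FDP (R : realType) (S : set nat) (D : {fset nat}) : R :=
  #|` [fset i in D | i \in S]%fset |%:R / (maxn #|` D| 1)%:R.

(* As FDP >= 0, starting from 0 does not change the maximum over a nonempty
   family. *)
Definition maxFDP (R : realType) (S : set nat) (C : {fset {fset nat}}) : R :=
  \big[Num.max/0]_(D <- C) FDP R S D.

Definition candidate_family_process d (T : measurableType d)
    (F : nat -> set (set T)) (It : nat -> {fset nat})
    (C : nat -> T -> {fset {fset nat}}) : Prop :=
  [/\ forall t w, C t w != fset0,
      forall t w (D : {fset nat}), D \in C t w -> (D `<=` It t)%fset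
    & forall t (D : {fset nat}), (D `<=` It t)%fset ->
        F t [set w | D \in C t w]].

Definition controls_stopped_FDR d (T : measurableType d) (R : realType)
    (F : nat -> set (set T)) (M : set (probability T R)) (I : set nat)
    (H : nat -> set (probability T R)) (It : nat -> {fset nat})
    (C : nat -> T -> {fset {fset nat}}) (alpha : R) : Prop :=
  forall P, M P -> forall tau, stopping_time F tau -> as_finite P tau ->
    ('E_P[stopped
            (fun t w =>
               maxFDP R (true_nulls I H P `&` [set` It t]) (C t w)) tau]
       <= alpha%:E)%E.

Definition eprocess d (T : measurableType d) (R : realType)
    (F : nat -> set (set T)) (H : set (probability T R))
    (E : nat -> T -> R) : Prop :=
  [/\ forall t w, 0 <= E t w,
      adapted F E
    & forall P, H P -> forall tau, stopping_time F tau -> as_finite P tau ->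
        ('E_P[stopped E tau] <= 1)%E].

(* A collection is a map E on all finite sets; only the values E S with S
   nonempty and included in I are meaningful. *)
Definition dynamic_intersection_eprocess d (T : measurableType d)
    (R : realType) (F : nat -> set (set T)) (M : set (probability T R))
    (I : set nat) (H : nat -> set (probability T R))
    (E : {fset nat} -> nat -> T -> R) : Prop :=
  forall S : {fset nat}, S != fset0 -> [set` S] `<=` I ->
    eprocess F (inter_null M H S) (E S).

Definition future_extension_coherent (T : Type) (R : realType) (I : set nat)
    (It : nat -> {fset nat}) (E : {fset nat} -> nat -> T -> R) : Prop :=
  forall (t : nat) (S : {fset nat}) (w : T),
    [set` S] `<=` I -> (S `&` It t)%fset != fset0 ->
    E (S `&` It t)%fset t w <= E S t w.

Definition closure_family (T : Type) (R : realType) (It : nat -> {fset nat})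
    (alpha : R) (E : {fset nat} -> nat -> T -> R) (t : nat) (w : T) :
    set {fset nat} :=
  [set D | (D `<=` It t)%fset /\
     forall S : {fset nat}, S != fset0 -> (S `<=` It t)%fset ->
       FDP R [set` S] D <= alpha * E S t w].

Definition Ecan (T : Type) (R : realType) (It : nat -> {fset nat})
    (C : nat -> T -> {fset {fset nat}}) (alpha : R)
    (S : {fset nat}) (t : nat) (w : T) : R :=
  alpha^-1 * maxFDP R ([set` S] `&` [set` It t]) (C t w).

(* Main.v *)
Require Import Defs.
From HB Require Import structures.
From mathcomp Require Import all_boot all_order all_algebra finmap.
From mathcomp Require Import all_classical all_reals all_analysis.
From mathcomp Require Import measurable_realfun.

Set Implicit Arguments.
Unset Strict Implicit.
Unset Printing Implicit Defensive.

Import Order.TTheory GRing.Theory Num.Theory.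
Import numFieldNormedType.Exports.

Local Open Scope classical_set_scope.
Local Open Scope ring_scope.

(** Write [FDP S D] for the proportion of members of [D] that lie in [S].  Each
    part of the theorem comes from an elementary property of the maximum of
    [FDP S D] over the candidates [D].
    - It is nondecreasing in [S] ([maxFDP_mono]).  If [P] lies in the
      intersection null of a finite [S], then [S] is included in the set of true
      nulls of [P].  At every time the maximum with respect to [S] is therefore
      at most the maximum with respect to the true nulls, whose value at any
      almost surely finite stopping time has expectation at most [alpha];
      dividing by [alpha] bounds the expectation of the stopped canonical
      process by [1] ([eprocess_Ecan]).
    - The canonical process depends on [S] only through its intersection with
      the active set, so that coherence holds, in fact with equality
      ([Ecan_fsetI]).
    - A maximum is at least each of its terms ([FDP_le_maxFDP]): the FDP of a
      candidate is at most [alpha] times the canonical process, which is the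
      closure inequality.

    What remains is measurability.  The candidate family is known only through
    the events that it contains a given deterministic set.  As it ranges over
    the subsets of a finite active set, its maximal FDP is a finite maximum
    over deterministic sets of functions supported on those events
    ([maxFDP_fpowersetE]), hence adapted ([adapted_maxFDP]).  The stopped
    process is then measurable because a random time with values in the
    natural numbers and infinity splits the sample space into countably many
    measurable pieces ([measurable_stopped]); this is what allows the
    expectations above to be compared and scaled. *)

(** * Monotonicity of the false discovery proportion *)

Lemma FDP_mono (R : realType) (S S' : set nat) (D : {fset nat}) :
  S `<=` S' -> FDP R S D <= FDP R S' D.
Proof.
move=> SS'; rewrite /FDP ler_wpM2r ?invr_ge0// ler_nat.
apply: fsubset_leq_card; apply/fsubsetP => i.
by rewrite !inE => /andP[-> /= /set_mem/SS'/mem_set].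
Qed.

Lemma maxFDP_ge0 (R : realType) (S : set nat) (C : {fset {fset nat}}) :
  0 <= maxFDP R S C.
Proof. exact: bigmax_ge_id. Qed.

Lemma FDP_le_maxFDP (R : realType) (S : set nat) (C : {fset {fset nat}})
    (D : {fset nat}) : D \in C -> FDP R S D <= maxFDP R S C.
Proof. by move=> DC; exact: le_bigmax_seq. Qed.

Lemma maxFDP_mono (R : realType) (S S' : set nat) (C : {fset {fset nat}}) :
  S `<=` S' -> maxFDP R S C <= maxFDP R S' C.
Proof.
move=> SS'; rewrite /maxFDP big_seq; apply: bigmax_le => [|D DC].
  exact: maxFDP_ge0.
exact: le_trans (FDP_mono _ _ SS') (FDP_le_maxFDP _ _ DC).
Qed.

(** Moves the randomness of the family [C] from the range of the maximum, which
    becomes the deterministic power set of [A], into the tests [D \in C], whose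
    measurability is the only thing known about a random family.  The value 0
    for absent sets is harmless since the maximum starts from 0. *)
Lemma maxFDP_fpowersetE (R : realType) (S : set nat) (A : {fset nat})
    (C : {fset {fset nat}}) :
  (forall D, D \in C -> (D `<=` A)%fset) ->
  maxFDP R S C =
    \big[Num.max/0]_(D <- fpowerset A) (if D \in C then FDP R S D else 0).
Proof.
move=> CA; apply/le_anti/andP; split.
  rewrite /maxFDP big_seq; apply: bigmax_le => [|D DC].
    exact: bigmax_ge_id.
  by apply: (@bigmax_sup_seq _ _ _ _ _ D); rewrite ?DC ?fpowersetE ?CA.
apply: bigmax_le => [|D _]; first exact: maxFDP_ge0.
by case: ifPn => [DC|_]; [exact: FDP_le_maxFDP|exact: maxFDP_ge0].
Qed.

(** * Measurability of adapted and stopped processes *)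

Lemma measurable_bigmaxr d (T : measurableType d) (R : realType)
    (J : Type) (r : seq J) (f : J -> T -> R) :
  (forall j, measurable_fun [set: T] (f j)) ->
  measurable_fun [set: T] (fun w => \big[Num.max/0]_(j <- r) f j w).
Proof.
move=> mf; elim: r => [|j r IH].
  by under eq_fun do rewrite big_nil; exact: measurable_cst.
by under eq_fun do rewrite big_cons; exact: measurable_maxr.
Qed.

Lemma adapted_maxFDP d (T : measurableType d) (R : realType)
    (F : nat -> set (set T)) (It : nat -> {fset nat})
    (C : nat -> T -> {fset {fset nat}}) (S : nat -> set nat) :
  candidate_family_process F It C ->
  adapted F (fun t w => maxFDP R (S t) (C t w)).
Proof.
move=> [_ CI mC] t.
under eq_fun do rewrite (maxFDP_fpowersetE _ _ (CI t _)).
(* Sets outside the active set at time t are never candidates, so for them the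
   event is empty. *)
have mD (D : {fset nat}) :
    measurable ([set w | D \in C t w] : set (g_sigma_algebraType (F t))).
  have [DI|DI] := boolP (D `<=` It t)%fset.
    by apply: sub_sigma_algebra; exact: mC.
  rewrite (_ : [set w | _] = set0)//; apply/seteqP; split => // w /= /CI.
  by rewrite (negbTE DI).
apply: measurable_bigmaxr => D; apply: measurable_fun_ifT.
- apply: (measurable_fun_bool true); rewrite setTI.
  by rewrite (_ : _ @^-1` _ = [set w | D \in C t w]).
- exact: measurable_cst.
- exact: measurable_cst.
Qed.

Lemma adapted_measurable d (T : measurableType d) (R : realType)
    (F : nat -> set (set T)) (X : nat -> T -> R) :
  is_filtration F -> adapted F X -> forall t, measurable_fun [set: T] (X t).
Proof.
move=> [sF Fm _] aX t _ B mB; apply: (Fm t).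
by rewrite -(sigma_algebra_id (sF t)); exact: aX.
Qed.

Lemma measurable_stopping_time_eq d (T : measurableType d)
    (F : nat -> set (set T)) (tau : T -> option nat) :
  is_filtration F -> stopping_time F tau ->
  forall t, measurable [set w | tau w = Some t].
Proof.
move=> [_ Fm _] st t.
have mle s : measurable [set w | exists2 u, tau w = Some u & (u <= s)%N].
  exact: (Fm s).
case: t => [|t].
  rewrite (_ : mkset _ = [set w | exists2 u, tau w = Some u & (u <= 0)%N])//.
  apply/seteqP; split => w /=; first by exists 0%N.
  by move=> [u ->]; rewrite leqn0 => /eqP ->.
rewrite (_ : mkset _ = [set w | exists2 u, tau w = Some u & (u <= t.+1)%N] `\`
   [set w | exists2 u, tau w = Some u & (u <= t)%N]); first exact: measurableD.
apply/seteqP; split => w /= => [->|[[u tu ut] nt]].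
  by split; [exists t.+1|case=> u [<-]; rewrite ltnn].
rewrite tu; congr Some; apply/eqP; rewrite eqn_leq ut /= ltnNge.
by apply/negP => ut'; apply: nt; exists u.
Qed.

Lemma measurable_stopped d (T : measurableType d) (R : realType)
    (F : nat -> set (set T)) (X : nat -> T -> R) (tau : T -> option nat) :
  is_filtration F -> adapted F X -> stopping_time F tau ->
  measurable_fun [set: T] (stopped X tau).
Proof.
move=> hF aX st.
have mSome := measurable_stopping_time_eq hF st.
(* Piece 0 is the event that the time is infinite, piece t.+1 the event that it
   is t. *)
pose A n := [set w | tau w = if n is t.+1 then Some t else None].
have mA n : measurable (A n).
  case: n => [|t]; last exact: mSome.
  rewrite (_ : A 0%N = ~` \bigcup_t [set w | tau w = Some t]).
    by apply: measurableC; apply: bigcupT_measurable.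
  apply/seteqP; split => w; rewrite /A /=; first by move=> tw [t _ /=]; rewrite tw.
  by case tw: (tau w) => [t|//] nt; case: nt; exists t.
rewrite (_ : setT = \bigcup_n A n); last first.
  apply/seteqP; split => // w _; case tw: (tau w) => [t|].
    by exists t.+1.
  by exists 0%N.
apply/measurable_fun_bigcup => // -[|t].
  apply: (eq_measurable_fun (cst (0 : R))); last exact: measurable_cst.
  by move=> w /set_mem; rewrite /A /stopped /= => ->.
apply: (eq_measurable_fun (X t)).
  by move=> w /set_mem; rewrite /A /stopped /= => ->.
by apply: measurable_funTS; exact: adapted_measurable aX t.
Qed.

(** * The canonical collection *)

(** Unlike linearity of the expectation on integrable variables, this form
    allows [X] to have infinite expectation. *)
Lemma ge0_expectationZl d (T : measurableType d) (R : realType)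
    (P : probability T R) (X : T -> R) (k : R) :
  measurable_fun [set: T] X -> (forall w, 0 <= X w) -> 0 <= k ->
  ('E_P[(fun w => (k * X w)%R)] = k%:E * 'E_P[X])%E.
Proof.
move=> mX X0 k0; rewrite unlock; under eq_integral do rewrite EFinM.
rewrite ge0_integralZl_EFin//; first by move=> w _; rewrite lee_fin.
exact/measurable_EFinP.
Qed.

Lemma adapted_scale d (T : measurableType d) (R : realType)
    (F : nat -> set (set T)) (X : nat -> T -> R) (k : R) :
  adapted F X -> adapted F (fun t w => k * X t w).
Proof. by move=> aX t; apply: measurable_funM => //; exact: aX. Qed.

Lemma stopped_scale (T : Type) (R : realType) (X : nat -> T -> R)
    (tau : T -> option nat) (k : R) :
  stopped (fun t w => k * X t w) tau = (fun w => k * stopped X tau w).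
Proof.
by apply/funext => w; rewrite /stopped; case: (tau w); rewrite ?mulr0.
Qed.

Lemma stopped_ge0 (T : Type) (R : realType) (X : nat -> T -> R)
    (tau : T -> option nat) (w : T) :
  (forall t w, 0 <= X t w) -> 0 <= stopped X tau w.
Proof. by move=> X0; rewrite /stopped; case: (tau w). Qed.

Lemma stopped_le (T : Type) (R : realType) (X Y : nat -> T -> R)
    (tau : T -> option nat) (w : T) :
  (forall t w, X t w <= Y t w) -> stopped X tau w <= stopped Y tau w.
Proof. by move=> XY; rewrite /stopped; case: (tau w). Qed.

Lemma inter_null_sub_true_nulls (Q : Type) (M : set Q) (I : set nat)
    (H : nat -> set Q) (S : {fset nat}) (P : Q) :
  [set` S] `<=` I -> inter_null M H S P -> [set` S] `<=` true_nulls I H P.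
Proof. by move=> SI [_ HP] i Si; split; [exact: SI|exact: HP]. Qed.

(** The true nulls of [P] are unknown, so the canonical process is indexed by
    arbitrary [S]; control with respect to the true nulls transfers to every [S]
    whose intersection null contains [P], since [S] then has only true nulls. *)
Lemma eprocess_Ecan d (T : measurableType d) (R : realType)
    (F : nat -> set (set T)) (M : set (probability T R)) (I : set nat)
    (H : nat -> set (probability T R)) (It : nat -> {fset nat}) (alpha : R)
    (C : nat -> T -> {fset {fset nat}}) (S : {fset nat}) :
  is_filtration F -> 0 < alpha -> candidate_family_process F It C ->
  controls_stopped_FDR F M I H It C alpha -> [set` S] `<=` I ->
  eprocess F (inter_null M H S) (Ecan It C alpha S).
Proof.
move=> hF a0 hC hFDR SI.
have ai0 : 0 <= alpha^-1 by rewrite invr_ge0 ltW.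
split=> [t w||P HP tau st tf].
- by rewrite /Ecan mulr_ge0// maxFDP_ge0.
- by apply: adapted_scale; exact: adapted_maxFDP hC.
have /hFDR/(_ tau st tf) : M P by case: HP.
set N := true_nulls I H P => EN.
have mX (S' : set nat) : measurable_fun [set: T]
    (stopped (fun t w => maxFDP R (S' `&` [set` It t]) (C t w)) tau).
  by apply: (measurable_stopped hF _ st); exact: adapted_maxFDP hC.
have X0 (S' : set nat) w :
    0 <= stopped (fun t w => maxFDP R (S' `&` [set` It t]) (C t w)) tau w.
  by apply: stopped_ge0 => t v; exact: maxFDP_ge0.
rewrite /Ecan stopped_scale ge0_expectationZl//.
rewrite lee_pdivrMl// mule1; apply: le_trans EN.
apply: expectation_le => //; apply: aeW => w; apply: stopped_le => t v.
by apply: maxFDP_mono; apply: setSI; exact: inter_null_sub_true_nulls HP.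
Qed.

Lemma Ecan_fsetI (T : Type) (R : realType) (It : nat -> {fset nat})
    (C : nat -> T -> {fset {fset nat}}) (alpha : R) (S : {fset nat})
    (t : nat) (w : T) :
  Ecan It C alpha (S `&` It t)%fset t w = Ecan It C alpha S t w.
Proof. by rewrite /Ecan set_fsetI -setIA setIid. Qed.

Theorem theorem7p1 (d : measure_display) (T : measurableType d) (R : realType)
    (F : nat -> set (set T)) (hF : is_filtration F)
    (M : set (probability T R)) (I : set nat)
    (H : nat -> set (probability T R)) (hH : forall i, I i -> H i `<=` M)
    (It : nat -> {fset nat}) (hI : active_sets I It)
    (alpha : R) (halpha : 0 < alpha <= 1)
    (C : nat -> T -> {fset {fset nat}})
    (hC : candidate_family_process F It C)
    (hFDR : controls_stopped_FDR F M I H It C alpha) :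
  [/\ dynamic_intersection_eprocess F M I H (Ecan It C alpha),
      future_extension_coherent I It (Ecan It C alpha)
    & forall (t : nat) (w : T),
        [set` C t w] `<=` closure_family It alpha (Ecan It C alpha) t w].
Proof.
have [a0 _] := andP halpha.
split=> [S _ SI|t S w _ _|t w D /= DC].
- exact: eprocess_Ecan hF a0 hC hFDR SI.
- by rewrite Ecan_fsetI.
have [_ CI _] := hC.
split=> [|S _ SIt]; first exact: CI DC.
have /setIidl SI : [set` S] `<=` [set` It t] by apply/fsubsetP.
rewrite /Ecan SI mulrA divff ?gt_eqF// mul1r.
exact: FDP_le_maxFDP.
Qed.
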